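(* Let $D$ be any infinite digraph. The map $\omega \mapsto f_\omega$ with domain $\Omega(D)$ is a bijection between the set $\Omega(D)$ of ends of $D$ and the set of vertex-directions of $D$.
   Context: Digraphs have no loops and no parallel edges, but may contain both edges $uv$ and $vu$. For a digraph $D$, $\mathcal{X}(D)$ denotes the set of finite subsets of $V(D)$. A (directed) ray is a digraph on distinct vertices $v_0,v_1,v_2,\dots$ with edges $v_iv_{i+1}$ ($i\ge 0$); its tails are its subrays $v_kv_{k+1}\dots$. A ray $R\subseteq D$ is solid in $D$ if for every $X\in\mathcal{X}(D)$ some tail of $R$ lies in a single strong component of $D-X$. Two solid rays are equivalent if for every $X\in\mathcal{X}(D)$ they have tails in the same strong component of $D-X$; the equivalence classes are the ends of $D$, and $\Omega(D)$ is the set of ends. For an end $\omega$ and $X\in\mathcal{X}(D)$, $C(X,\omega)$ denotes the strong component of $D-X$ containing a tail of every ray in $\omega$. A vertex-direction of $D$ is a map $f$ with domain $\mathcal{X}(D)$ sending each $X\in\mathcal{X}(D)$ to a strong component of $D-X$ such that $f(X)\supseteq f(Y)$ whenever $X\subseteq Y$. For an end $\omega$, $f_\omega$ is the vertex-direction $X\mapsto C(X,\omega)$. *)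

(* Defs.v *)
From Stdlib Require Import Relation_Operators.
From mathcomp Require Import all_boot.
From mathcomp Require Import boolp classical_sets functions cardinality.

Set Implicit Arguments.
Unset Strict Implicit.
Unset Printing Implicit Defensive.

Local Open Scope classical_set_scope.

(* Having an edge relation rather than an edge family excludes parallel edges;
   [edge u v] and [edge v u] may both hold. *)
Record digraph := Digraph {
  vertex :> Type;
  edge : vertex -> vertex -> Prop;
  edge_irrefl : forall v, ~ edge v v }.

Section Digraph.
Variable D : digraph.

Definition fin_subset := {X : set D | finite_set X}.

(* There is a directed path from [u] to [v] in the induced subdigraph D[A]. *)
Definition reachable_in (A : set D) (u v : D) : Prop :=
  clos_refl_trans D (fun x y => [/\ A x, A y & edge x y]) u v.

Definition strongly_connected (A : set D) : Prop :=
  A !=set0 /\ forall u v, A u -> A v -> reachable_in A u v.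

(* Strong components (maximal strongly connected subdigraphs) are induced
   subdigraphs, so they are represented by their vertex sets.
   [strong_component X K] : K is a strong component of D - X. *)
Definition strong_component (X : fin_subset) (K : set D) : Prop :=
  [/\ K `<=` ~` sval X, strongly_connected K &
      forall K' : set D, K' `<=` ~` sval X -> strongly_connected K' ->
        K `<=` K' -> K' = K].

(* A ray determines the enumeration v_0, v_1, ... of its vertices. *)
Definition ray (r : nat -> D) : Prop :=
  injective r /\ forall i, edge (r i) (r i.+1).

Definition has_tail_in (r : nat -> D) (K : set D) : Prop :=
  exists k, forall i, k <= i -> K (r i).

Definition solid_ray (r : nat -> D) : Prop :=
  ray r /\ forall X, exists2 K, strong_component X K & has_tail_in r K.

Definition ray_equiv (r s : nat -> D) : Prop :=
  forall X, exists2 K, strong_component X K & has_tail_in r K /\ has_tail_in s K.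

Definition ends : set (set (nat -> D)) :=
  [set w | exists2 r, solid_ray r & w = [set s | solid_ray s /\ ray_equiv r s]].

Definition contains_tails (X : fin_subset) (w : set (nat -> D)) (K : set D) :
    Prop :=
  strong_component X K /\ forall r, w r -> has_tail_in r K.

(* C(X, w); the default value [set0] of [xget] is irrelevant when w is an end,
   see [end_componentP]. *)
Definition end_component (X : fin_subset) (w : set (nat -> D)) : set D :=
  xget set0 [set K | contains_tails X w K].

Definition vertex_directions : set (fin_subset -> set D) :=
  [set f | (forall X, strong_component X (f X)) /\
           (forall X Y, sval X `<=` sval Y -> f Y `<=` f X)].

Definition end_direction (w : set (nat -> D)) : fin_subset -> set D :=
  fun X => end_component X w.

Lemma reachable_in_sub (A B : set D) u v :
  A `<=` B -> reachable_in A u v -> reachable_in B u v.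
Proof.
move=> AB; elim=> [x y [Ax Ay xy]|x|x y z _ xy _ yz].
- by apply: rt_step; split=> //; exact: AB.
- exact: rt_refl.
- exact: rt_trans xy yz.
Qed.

Lemma strong_component_eq X (K L : set D) x :
  strong_component X K -> strong_component X L -> K x -> L x -> K = L.
Proof.
move=> [KX [_ Ks] Kmax] [LX [_ Ls] Lmax] Kx Lx.
have Us : strongly_connected (K `|` L).
  split=> [|u v Uu Uv]; first by exists x; left.
  apply: (@rt_trans _ _ _ x).
    case: Uu => [Ku|Lu].
      by apply: (@reachable_in_sub K) => [y Ky|]; [left|exact: Ks].
    by apply: (@reachable_in_sub L) => [y Ly|]; [right|exact: Ls].
  case: Uv => [Kv|Lv].
    by apply: (@reachable_in_sub K) => [y Ky|]; [left|exact: Ks].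
  by apply: (@reachable_in_sub L) => [y Ly|]; [right|exact: Ls].
have UX : K `|` L `<=` ~` sval X by move=> y [/KX|/LX].
have UK : K `|` L = K by apply: Kmax => // y Ky; left.
have UL : K `|` L = L by apply: Lmax => // y Ly; right.
exact: etrans (esym UK) UL.
Qed.

Lemma tail_component_eq X (K L : set D) r :
  strong_component X K -> strong_component X L ->
  has_tail_in r K -> has_tail_in r L -> K = L.
Proof.
move=> HK HL [k rK] [l rL].
apply: (@strong_component_eq X K L (r (maxn k l))) => //.
- by apply: rK; exact: leq_maxl.
- by apply: rL; exact: leq_maxr.
Qed.

Lemma end_componentP X w : ends w ->
  contains_tails X w (end_component X w) /\
  forall K, contains_tails X w K -> K = end_component X w.
Proof.
move=> [r [rr rs] we].
have wr : w r.
  by rewrite we; split=> // Y; have [K KY rK] := rs Y; exists K.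
have [K KX rK] := rs X.
have wK : contains_tails X w K.
  split=> // s; rewrite we => -[_ /(_ X)[L LX [rL sL]]].
  by rewrite (tail_component_eq KX LX rK rL).
have wC : contains_tails X w (end_component X w) by exact: xgetI wK.
split=> // L [LX wL]; apply: (@tail_component_eq X L _ r) => //.
- by case: wC.
- exact: wL.
- by case: wC => _; exact.
Qed.

End Digraph.

Arguments ends : clear implicits.
Arguments vertex_directions : clear implicits.
Arguments end_direction : clear implicits.

(* Main.v *)
(** Only surjectivity is hard: given a vertex-direction f, find a ray with a
    tail in every f(X).  If D is countable, take an increasing sequence of finite
    sets X_n exhausting D and follow shortest paths inside f(X_n) from f(X_n) to
    f(X_(n+1)).

    In general, let V be a countable set of vertices such that f(Y) ∩ V is
    strongly connected for all finite Y ⊆ V, and such that whenever v ∈ V and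
    Z ⊆ V are avoided by some finite X with v ∉ f(X), they are avoided by such an
    X inside V.  The construction above, carried out inside V, gives a ray with a
    tail in f(Y) ∩ V for every finite Y ⊆ V, so it suffices that
    f(X ∩ V) ∩ V ⊆ f(X) for every finite X.  If v violated this, then f(X) would
    not meet V, and v could reach f(X), and be reached from it, along paths
    meeting V only in a finite set Z disjoint from X.  Reflect X to a finite
    S ⊆ V avoiding v and Z with v ∉ f(S): the two paths avoid S, and extend inside
    f(X) to f(X ∪ S) ⊆ f(S), so v ∈ f(S), a contradiction. *)

From Stdlib Require Import Relation_Operators Operators_Properties.
Require Import Defs.
From mathcomp Require Import all_boot.
From mathcomp Require Import boolp classical_sets functions cardinality.

Local Open Scope classical_set_scope.

(** * Countable sets closed under finite witnesses *)

Lemma finite_sub_range {T : Type} (x0 : T) {A : set T} :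
  finite_set A -> exists h : nat -> T, A `<=` range h.
Proof.
move=> /finite_set_countable/countable_injP[j jinj].
have /choice[h hP] : forall n, exists x, (exists2 y, A y & j y = n) ->
    A x /\ j x = n.
  move=> n; have [[y Ay yn]|nA] := pselect (exists2 y, A y & j y = n).
    by exists y.
  by exists x0.
exists h => x Ax; exists (j x) => //.
have [Ah jh] := hP (j x) (ex_intro2 _ _ x Ax erefl).
by apply: jinj; rewrite ?inE.
Qed.

Lemma finite_sub_range_bounded {T : Type} {Y : set T} {e : nat -> T} :
  finite_set Y -> Y `<=` range e ->
  exists n, Y `<=` [set e i | i in `I_n].
Proof.
move=> Yfin Ye.
have /choice[p pP] : forall y, exists i, Y y -> e i = y.
  move=> y; have [Yy|nY] := pselect (Y y); last by exists 0.
  by have [i _ eiy] := Ye y Yy; exists i.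
have /finite_seqP[s sP] := finite_image p Yfin.
exists (\max_(i <- s) i).+1 => y Yy; exists (p y); last exact: pP.
have : [set` s] (p y) by rewrite -sP; exists y.
by rewrite /= ltnS => ps; exact: (leq_bigmax_seq _ ps).
Qed.

(* The closure is the set of values of the terms (trees) built from [g]. *)
Lemma countable_closure {T : Type} (g : nat -> seq T -> T) :
  exists e : nat -> T, forall n (s : seq nat), range e (g n (map e s)).
Proof.
pose ev := fix ev (t : GenTree.tree nat) : T :=
  match t with
  | GenTree.Leaf _ => g 0 [::]
  | GenTree.Node n ts => g n (map ev ts)
  end.
pose t k := odflt (GenTree.Leaf 0) (unpickle k : option (GenTree.tree nat)).
exists (ev \o t) => n s; exists (pickle (GenTree.Node n (map t s))) => //.
by rewrite /= /t pickleK /= -map_comp.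
Qed.

(* A form of the downward Loewenheim-Skolem theorem. *)
Lemma countable_reflection {T : Type} (x0 : T)
    (P : set T -> T -> T -> set T -> Prop) :
  (forall Y v w, finite_set Y -> exists2 A, finite_set A & P Y v w A) ->
  exists e : nat -> T, forall Y v w, finite_set Y ->
    Y `<=` range e -> range e v -> range e w ->
    exists2 A, A `<=` range e & P Y v w A.
Proof.
move=> HP.
have /choice[h hP] : forall q : set T * T * T, exists h : nat -> T,
    finite_set q.1.1 -> exists2 A, A `<=` range h & P q.1.1 q.1.2 q.2 A.
  move=> [[Y v] w] /=; have [Yfin|nY] := pselect (finite_set Y); last first.
    by exists (fun=> x0).
  have [A Afin PA] := HP Y v w Yfin.
  by have [h Ah] := finite_sub_range x0 Afin; exists h => _; exists A.
(* A list codes a query: [v], [w], then the elements of [Y]. The values of [g] at it, as [n] varies,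
   run through a set covering a witness, so closure under [g] captures the whole witness. *)
pose g n (s : seq T) := match s with
  | [:: v, w & s'] => h ([set nth x0 s' i | i in `I_(size s')], v, w) n
  | _ => x0
  end.
have [e eg] := countable_closure g.
exists e => Y _ _ Yfin Ye [iv _ <-] [iw _ <-].
have [n Yn] := finite_sub_range_bounded Yfin Ye.
have [s sY] : exists s : seq nat, Y = [set e i | i in [set` s]].
  pose s := [seq i <- iota 0 n | `[< Y (e i) >] ].
  exists s; apply/seteqP; split=> [y Yy|_ [i /= + <-]]; last first.
    by rewrite mem_filter => /andP[/asboolP].
  have [i /= iltn eiy] := Yn y Yy; exists i => //=.
  by rewrite mem_filter mem_iota /= add0n iltn andbT eiy; apply/asboolP.
have YE : [set nth x0 (map e s) i | i in `I_(size (map e s))] = Y.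
  rewrite sY size_map; apply/seteqP; split=> _ [i /= si <-].
    by exists (nth 0 s i); rewrite ?(nth_map 0) //= mem_nth.
  by exists (index i s); rewrite /= ?index_mem // (nth_map 0) ?index_mem // nth_index.
have [A Ah PA] := hP (Y, e iv, e iw) Yfin.
exists A => // x /Ah[k _ <-].
by have := eg k [:: iv, iw & s]; rewrite /= YE.
Qed.

(** * Finite covers and last exits of directed paths *)

Section Reachability.
Context {T : Type}.
Implicit Types (E : T -> T -> Prop) (A B C K : set T).

(* [reach (@edge D)] is [@reachable_in D]; the edge relation is a parameter so
   that lemmas can be applied to the reverse digraph. *)
Definition reach E A : T -> T -> Prop :=
  clos_refl_trans T (fun x y => [/\ A x, A y & E x y]).

Lemma reach_sub {E A B u v} : A `<=` B -> reach E A u v -> reach E B u v.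
Proof.
move=> AB; elim=> [x y [Ax Ay xy]|x|x y z _ xy _ yz].
- by apply: rt_step; split=> //; exact: AB.
- exact: rt_refl.
- exact: rt_trans xy yz.
Qed.

Lemma reach_flip {E A u v} : reach E A u v -> reach (fun x y => E y x) A v u.
Proof.
elim=> [x y [Ax Ay xy]|x|x y z _ xy _ yz].
- exact: rt_step.
- exact: rt_refl.
- exact: rt_trans yz xy.
Qed.

Lemma reach_mem {E A u v} : A u -> reach E A u v -> A v.
Proof. by move=> + uv; elim: uv => [x y []|//|x y z _ xy _ yz /xy /yz]. Qed.

Lemma reach_finite {E A u v} : A u -> reach E A u v ->
  exists Q, [/\ finite_set Q, Q `<=` A & reach E Q u v].
Proof.
move=> + uv; elim: uv => [x y [Ax Ay xy] _|x Ax|x y z xy IHxy yz IHyz Ax].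
- exists [set x; y]; split=> //; first by move=> _ [->|->].
  by apply: rt_step; split=> //; [left|right].
- by exists [set x]; split=> //; [move=> _ ->|exact: rt_refl].
- have [Q [Qfin QA Qxy]] := IHxy Ax.
  have [Q' [Q'fin Q'A Q'yz]] := IHyz (reach_mem Ax xy).
  exists (Q `|` Q'); split; first by rewrite finite_setU.
    by move=> w [/QA|/Q'A].
  apply: rt_trans (reach_sub _ Qxy) (reach_sub _ Q'yz) => w Qw.
    by left.
  by right.
Qed.

(** Induction from the start of the path: an exit found in the remainder stays the last one. The set
    after [x] records that each later vertex still reaches [k] outside [X]. *)
Lemma reach_last_exit {E C X u k} : C u -> reach E C u k ->
  reach E (C `\` X) u k \/
  exists x, [/\ X x, reach E C u x &
    reach E (x |` [set w | (C `\` X) w /\ reach E (C `\` X) w k]) x k].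
Proof.
move=> + uk; have {uk} := clos_rt_rt1n _ _ _ _ uk.
elim=> [x _|x y z [Cx Cy xy] _ IH _]; first by left; exact: rt_refl.
have [yz|[a [Xa ya az]]] := IH Cy; last first.
  by right; exists a; split=> //; apply: rt_trans ya; apply: rt_step.
(* Reachability is reflexive, so [y] may lie in [X]; the remaining path is then empty. *)
have [Xy|nXy] := pselect (X y).
  right; exists y; split=> //; first exact: rt_step.
  have {yz} := clos_rt_rt1n _ _ _ _ yz.
  by case=> [|y' z' [[_ /(_ Xy)]]//]; exact: rt_refl.
have [Xx|nXx] := pselect (X x); last first.
  by left; apply: rt_trans yz; apply: rt_step.
right; exists x; split=> //; first exact: rt_refl.
apply: (@rt_trans _ _ _ y).
  by apply: rt_step; split=> //; [left|right; split].
move/(clos_rt_rt1n _ _ _ _): yz; elim=> [b|b c d [Cb Cc bc] cd IHd].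
  exact: rt_refl.
have cd' : reach E (C `\` X) c d by exact: clos_rt1n_rt.
apply: rt_trans IHd; apply: rt_step; split=> //; right; split=> //.
by apply: rt_trans cd'; apply: rt_step.
Qed.

(* If [v] cannot reach [K] outside [X], follow a path to [K] up to its last
   vertex [x] in [X], and let [Q] cover this part: no vertex beyond [x] lies in
   [V], since it would be reachable from [v] outside [X]. *)
Lemma reach_avoiding {E C X K V v k} : C v -> reach E C v k -> K k ->
  (forall w, C w -> V w -> reach E (C `\` X) v w) ->
  (forall x, C x -> X x -> V x -> False) ->
  exists2 Q, finite_set Q & forall S : set T, S `<=` V ->
    (forall x, C x -> Q x -> S x -> False) ->
    exists2 k', K k' & reach E (C `\` S) v k'.
Proof.
move=> Cv vk Kk VX CXV.
have [[k' [Kk' vk']]|nvK] :=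
    pselect (exists k', K k' /\ reach E (C `\` X) v k').
  have vk'C : reach E C v k' by apply: reach_sub vk' => w [].
  have [Q [Qfin QC Qvk]] := reach_finite Cv vk'C.
  exists Q => // S SV SQ; exists k' => //.
  by apply: reach_sub Qvk => w Qw; split=> [|Sw]; [exact: QC|exact: (SQ w (QC w Qw))].
have [vk'|[x [Xx vx xk]]] := reach_last_exit (X := X) Cv vk.
  by case: nvK; exists k.
have Cx := reach_mem Cv vx.
have [Q [Qfin QC Qvx]] := reach_finite Cv vx.
exists Q => // S SV SQ; exists k => //.
apply: rt_trans (reach_sub _ Qvx) (reach_sub _ xk).
  by move=> w Qw; split=> [|Sw]; [exact: QC|exact: (SQ w (QC w Qw))].
move=> w [->|[[Cw Xw] wk]]; split=> // Sw; first exact: (CXV x Cx Xx (SV _ Sw)).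
by apply: nvK; exists k; split=> //; apply: rt_trans wk; apply: VX => //; exact: SV.
Qed.

End Reachability.

(** * Closure properties of strong components *)

Section StrongComponents.
Context {D : digraph}.
Implicit Types (X Y : fin_subset D) (K L : set D).

(** The vertices mutually reachable with [a] outside [X] form a strongly connected set containing
    [K], which equals [K] by maximality. *)
Lemma strong_component_closed {X K a b c} : strong_component X K ->
  K a -> K b -> reachable_in (~` sval X) a c -> reachable_in (~` sval X) c b ->
  K c.
Proof.
move=> [KX [_ Ks] Kmax] Ka Kb ac cb.
pose A := ~` sval X.
pose K' := [set d | reachable_in A a d /\ reachable_in A d a].
have KA u v : K u -> K v -> reachable_in A u v.
  by move=> Ku Kv; apply: reachable_in_sub KX (Ks _ _ Ku Kv).
suff -> : K = K' by split=> //; apply: rt_trans cb (KA _ _ Kb Ka).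
have Aa : A a by exact: KX.
have in_K' u v : K' u -> K' v -> reachable_in A u v -> reachable_in K' u v.
  move=> + + /(clos_rt_rt1n _ _ _ _) uv; elim: uv => [x _ _|x y z [Ax Ay xy] yz IH Kx Kz].
    exact: rt_refl.
  have {}yz : reachable_in A y z by exact: clos_rt1n_rt.
  have K'y : K' y.
    split; first by apply: rt_trans Kx.1 _; apply: rt_step.
    exact: rt_trans yz Kz.2.
  by apply: rt_trans (IH K'y Kz); apply: rt_step.
symmetry; apply: Kmax.
- by move=> d [ad _]; exact: (reach_mem (E := @edge D) Aa ad).
- split=> [|u v Ku Kv]; first by exists a; split; exact: rt_refl.
  by apply: in_K' => //; apply: rt_trans Ku.2 Kv.1.
- by move=> d Kd; split; exact: KA.
Qed.

Lemma strongly_connected_sub_component {X K L x} : strong_component X K ->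
  L `<=` ~` sval X -> strongly_connected L -> K x -> L x -> L `<=` K.
Proof.
move=> KX LX [_ Ls] Kx Lx y Ly.
by apply: (strong_component_closed KX Kx Kx);
  apply: reachable_in_sub LX _; exact: Ls.
Qed.

End StrongComponents.

(** * A ray through a decreasing sequence of strongly connected sets *)

Section RayConstruction.
Context {D : digraph}.

Definition walk (A : set D) := fix walk k (u v : D) : Prop :=
  if k is k'.+1 then exists2 w, [/\ A u, A w & edge u w] & walk k' w v
  else u = v.

Lemma reachable_walk {A : set D} {u v} :
  reachable_in A u v -> exists k, walk A k u v.
Proof.
move/(clos_rt_rt1n _ _ _ _); elim=> [x|x y z xy _ [k yz]]; first by exists 0.
by exists k.+1; exists y.
Qed.

(* The ray follows shortest paths from [W n] into [W n.+1].  It is injective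
   because each step either reaches a deeper level or decreases the distance to
   the next one. *)
Lemma ray_through_levels (W : nat -> set D) :
  (forall n, W n.+1 `<=` W n) -> (forall n, strongly_connected (W n)) ->
  (forall x, exists n, ~ W n x) ->
  exists2 r, ray r & forall n, has_tail_in r (W n).
Proof.
move=> Wdec Wsc Wempty.
have Wle m n : m <= n -> W n `<=` W m.
  by move=> /subnKC <-; elim: (n - m) => [|k IH]; rewrite ?addn0 ?addnS // => x /Wdec/IH.
(* [l x] counts the levels containing [x], so for [x] in [W 0] the deepest one has index [(l x).-1].
   Walks inside it aim at [W (l x)], and [d x] is the least length of such a walk. *)
have /choice[l lP] : forall x, exists n, forall m, W m x <-> m < n.
  move=> x; have ex : exists n, ~~ `[< W n x >].
    by have [n nW] := Wempty x; exists n; apply/asboolPn.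
  case: (ex_minnP ex) => n /asboolPn nW nmin; exists n => m; split=> [Wm|mn].
    by rewrite ltnNge; apply/negP => nm; apply: nW; apply: Wle Wm.
  by apply: contrapT => nWm; have := nmin m; rewrite leqNgt mn => /(_ (introT (asboolPn _) nWm)).
pose walkto x k := exists2 y, W (l x) y & walk (W (l x).-1) k x y.
have /choice[d dP] : forall x, exists k, W 0 x ->
    walkto x k /\ forall j, walkto x j -> k <= j.
  move=> x; have [W0|nW0] := pselect (W 0 x); last by exists 0.
  have [y Wy] := (Wsc (l x)).1.
  have Wx : W (l x).-1 x by apply/lP; rewrite prednK //; apply/lP.
  have [k xy] := reachable_walk ((Wsc (l x).-1).2 x y Wx (Wle _ _ (leq_pred _) _ Wy)).
  have ex : exists k, `[< walkto x k >] by exists k; apply/asboolP; exists y.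
  case: (ex_minnP ex) => {xy}k /asboolP xk kmin; exists k => _; split=> // j xj.
  by apply: kmin; apply/asboolP.
have /choice[nxt nxtP] : forall x, exists y, W 0 x -> [/\ W 0 y, edge x y &
    l x < l y \/ l x = l y /\ d y < d x].
  move=> x; have [W0|nW0] := pselect (W 0 x); last by exists x.
  (* The shortest walk is not empty, since its end lies in [W (l x)] and [x] does not; its second
     vertex is the successor. *)
  have [[y Wy]] := dP x W0; case dx : (d x) => [|k] /=.
    by move=> xy; move: Wy; rewrite -xy => /lP; rewrite ltnn.
  move=> [z [Wx Wz xz] zy] _; exists z => _.
  have W0z := Wle _ _ (leq0n _) _ Wz; split=> //.
  have lz : l x <= l z.
    by have := (lP z _).1 Wz; rewrite prednK //; apply/lP.
  move: lz; rewrite leq_eqVlt => /orP[/eqP lxz|]; last by left.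
  right; split=> //; rewrite ltnS; apply: (dP z W0z).2.
  by exists y; rewrite -lxz.
have [x0 W0x0] := (Wsc 0).1.
pose r i := iter i nxt x0.
have W0r i : W 0 (r i) by elim: i => //= i /nxtP[].
have step i : l (r i) < l (r i.+1) \/ l (r i) = l (r i.+1) /\ d (r i.+1) < d (r i).
  by have [] := nxtP (r i) (W0r i).
have lmono i j : i <= j -> l (r i) <= l (r j).
  move=> /subnKC <-; elim: (j - i) => [|k IH]; rewrite ?addn0 ?addnS //.
  by apply: leq_trans IH _; case: (step (i + k)) => [/ltnW|[->]].
have prog i k : l (r i) < l (r (i + k.+1)) \/
    l (r i) = l (r (i + k.+1)) /\ d (r (i + k.+1)) < d (r i).
  elim: k => [|k IH]; first by rewrite addn1; exact: step.
  rewrite [i + k.+2]addnS; case: IH (step (i + k.+1)) => [lt1|[eq1 d1]] [lt2|[eq2 d2]].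
  - by left; apply: ltn_trans lt2.
  - by left; rewrite -eq2.
  - by left; rewrite eq1.
  - by right; split; [rewrite eq1|apply: ltn_trans d1].
have rneq i j : i < j -> r i <> r j.
  move=> /subnKC <-; rewrite addSnnS => eqr.
  by have := prog i (j - i.+1); rewrite -eqr !ltnn; case=> // -[].
(* While the level is constant [d] decreases, so the level must rise eventually. *)
have lunb n : exists i, n <= l (r i).
  elim: n => [|n [i ni]]; first by exists 0.
  have [k] := ubnP (d (r i)); elim: k i ni => // k IH i ni dk.
  case: (step i) => [lt|[eq lt]]; first by exists i.+1; exact: leq_ltn_trans lt.
  by apply: (IH i.+1); [rewrite -eq|exact: leq_trans lt _].
exists r.
  split=> [i j eqr|i]; last by have [] := nxtP (r i) (W0r i).
  by case: (ltngtP i j) => // /rneq; rewrite eqr.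
move=> n; have [i ni] := lunb n.+1.
by exists i => j ij; apply/lP; apply: leq_trans ni (lmono _ _ ij).
Qed.

End RayConstruction.

(** * From a vertex-direction to a ray *)

Section VertexDirection.
Context {D : digraph} (f : fin_subset D -> set D) (hf : vertex_directions D f).

Implicit Types X Y Z : fin_subset D.

Let comp X : strong_component X (f X) := hf.1 X.
Let mono X Y : sval X `<=` sval Y -> f Y `<=` f X := @hf.2 X Y.

Let fU (X Y : fin_subset D) : fin_subset D :=
  exist _ (sval X `|` sval Y)
    (eq_ind_r id (conj (svalP X) (svalP Y)) (finite_setU (sval X) (sval Y))).

(* [range e] plays the role of a countable elementary substructure containing
   [f]. *)
Lemma exists_reflecting_sequence : exists e : nat -> D,
  (forall Y, sval Y `<=` range e -> strongly_connected (f Y `&` range e)) /\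
  (forall Z v, sval Z `<=` range e -> range e v ->
     (exists X, [/\ sval X `&` sval Z = set0, ~ sval X v & ~ f X v]) ->
     exists X, [/\ sval X `<=` range e, sval X `&` sval Z = set0,
                   ~ sval X v & ~ f X v]).
Proof.
have [x0 _] : f (exist _ set0 (finite_set0 D)) !=set0.
  by case: (comp (exist _ set0 (finite_set0 D))) => _ [].
(* [Y] has two roles: the argument of [f] in the first two clauses, the set to be avoided in the
   third. *)
pose P (Y : set D) v w (A : set D) := forall Yfin : finite_set Y,
  let Y' : fin_subset D := exist _ Y Yfin in
  [/\ f Y' `&` A !=set0,
      f Y' v -> f Y' w -> reachable_in (f Y' `&` A) v w &
      (exists X, [/\ sval X `&` Y = set0, ~ sval X v & ~ f X v]) ->
      exists X, [/\ sval X `<=` A, sval X `&` Y = set0,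
                    ~ sval X v & ~ f X v] ].
have PA (Y : set D) v w : finite_set Y -> exists2 A, finite_set A & P Y v w A.
  move=> Yfin; pose Y' : fin_subset D := exist _ Y Yfin.
  have [_ [[y Yy] Ys] _] := comp Y'.
  have [Q Qfin HQ] : exists2 Q, finite_set Q & f Y' v -> f Y' w ->
      reachable_in (f Y' `&` Q) v w.
    have [Yv|nYv] := pselect (f Y' v); last by exists set0.
    have [Yw|nYw] := pselect (f Y' w); last by exists set0.
    have [Q [Qfin QY Qvw]] := reach_finite (E := @edge D) Yv (Ys _ _ Yv Yw).
    by exists Q => // _ _; apply: reach_sub Qvw => x Qx; split=> //; exact: QY.
  have [S Sfin HS] : exists2 S, finite_set S &
      (exists X, [/\ sval X `&` Y = set0, ~ sval X v & ~ f X v]) ->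
      exists X, [/\ sval X `<=` S, sval X `&` Y = set0, ~ sval X v & ~ f X v].
    have [[X [XY Xv fX]]|nX] := pselect (exists X : fin_subset D,
        [/\ sval X `&` Y = set0, ~ sval X v & ~ f X v]); last by exists set0.
    by exists (sval X) => [|_]; [exact: (svalP X)|exists X; split=> // x].
  exists ([set y] `|` Q `|` S); first by rewrite !finite_setU.
  move=> Yfin'; have -> : exist _ Y Yfin' = Y' by congr exist; exact: Prop_irrelevance.
  split; first by exists y; split=> //; left; left.
    move=> Yv Yw; apply: reachable_in_sub (HQ Yv Yw) => x [? ?]; split=> //.
    by left; right.
  by move=> /HS[X [XS ? ? ?]]; exists X; split=> // x /XS; right.
have [e eP] := countable_reflection x0 P PA.
have e0 : range e (e 0) by exists 0.
exists e; split=> [[Y Yfin]|[Z Zfin] v] /= sub.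
  split=> [|u v [fu eu] [fv ev]].
    have [A Ae /(_ Yfin)[[x [fx Ax]] _ _]] := eP Y _ _ Yfin sub e0 e0.
    by exists x; split=> //; exact: Ae.
  have [A Ae /(_ Yfin)[_ /(_ fu fv) uv _]] := eP Y _ _ Yfin sub eu ev.
  by apply: reachable_in_sub uv => x [? /Ae].
move=> ev hX; have [A Ae /(_ Zfin)[_ _ /(_ hX)[X [XA ? ? ?]]]] :=
  eP Z _ _ Zfin sub ev ev.
by exists X; split=> // x /XA /Ae.
Qed.

Lemma reflecting_sub_component (V : set D) :
  (forall Y, sval Y `<=` V -> strongly_connected (f Y `&` V)) ->
  (forall Z v, sval Z `<=` V -> V v ->
     (exists X, [/\ sval X `&` sval Z = set0, ~ sval X v & ~ f X v]) ->
     exists X, [/\ sval X `<=` V, sval X `&` sval Z = set0,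
                   ~ sval X v & ~ f X v]) ->
  forall X Y, sval Y = sval X `&` V -> f Y `&` V `<=` f X.
Proof.
move=> Vsc Vrefl X Y YXV v [fYv Vv]; apply: contrapT => nfXv.
have [fYY [_ fYs] _] := comp Y.
have [fXX [[k fXk] fXs] _] := comp X.
have fXY : f X `<=` f Y by apply: mono; rewrite YXV => x [].
have [_ Ws] : strongly_connected (f Y `&` V) by apply: Vsc; rewrite YXV => x [].
have fYXV x : f Y x -> sval X x -> V x -> False.
  by move=> /fYY Yx Xx Vx; apply: Yx; rewrite YXV.
have WX : f Y `&` V `<=` f Y `\` sval X.
  by move=> x [fx Vx]; split=> // Xx; exact: (fYXV x).
have fYX : f Y `\` sval X `<=` ~` sval X by move=> x [].
have vW w : f Y w -> V w -> reachable_in (f Y `\` sval X) v w.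
  by move=> fw Vw; apply: reachable_in_sub WX _; exact: Ws.
have Wv w : f Y w -> V w -> reachable_in (f Y `\` sval X) w v.
  by move=> fw Vw; apply: reachable_in_sub WX _; exact: Ws.
(* A vertex of [V] in [f X] would pull [v] into [f X], as the two reach each other outside [X]. *)
have fXV x : f X x -> V x -> False.
  move=> fx Vx; apply: nfXv; have fYx := fXY _ fx.
  apply: (strong_component_closed (comp X) fx fx);
    apply: reachable_in_sub fYX _; [exact: Wv|exact: vW].
have vk := fYs _ _ fYv (fXY _ fXk).
have kv := fYs _ _ (fXY _ fXk) fYv.
have [Q Qfin QP] :=
  reach_avoiding (E := @edge D) fYv vk fXk vW fYXV.
have [Q' Q'fin Q'P] := reach_avoiding (E := fun x y => edge y x) fYv
  (reach_flip kv) fXk (fun w fw Vw => reach_flip (Wv w fw Vw)) fYXV.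
(* Removing [Y], which is the trace of [X] on [V], makes this set disjoint from [X], as reflection
   requires. Nothing is lost, since [f Y] misses [Y]. *)
have Zfin : finite_set ((Q `|` Q') `&` (V `\` sval Y)).
  by apply: finite_setIl; rewrite finite_setU.
have [S [SV SZ nSv nfSv]] : exists S : fin_subset D, [/\ sval S `<=` V,
    sval S `&` ((Q `|` Q') `&` (V `\` sval Y)) = set0, ~ sval S v & ~ f S v].
  apply: (Vrefl (exist _ _ Zfin)) => //=; first by move=> x [_ []].
  exists X; split=> //; last by move=> Xv; exact: (fYXV v).
  by apply/seteqP; split=> // x [Xx [_ [Vx]]]; rewrite YXV; apply.
have SQ x : f Y x -> Q x \/ Q' x -> sval S x -> False.
  move=> fx Qx Sx; have : set0 x; last by [].
  by rewrite -SZ; split=> //; split=> //; split; [exact: SV|exact: fYY].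
have [a fXa va] := QP _ SV (fun x fx Qx => SQ x fx (or_introl Qx)).
have [b fXb bv] := Q'P _ SV (fun x fx Qx => SQ x fx (or_intror Qx)).
(* [c] lies in [f S] and is joined to [a] and [b] inside [f X], which avoids [S] because it misses
   [V]. *)
have [_ [[c fc] _] _] := comp (fU X S).
have fXc : f X c by apply: mono fc => x; left.
have fSc : f S c by apply: mono fc => x; right.
have fXS : f X `<=` ~` sval S by move=> x fx Sx; exact: (fXV x fx (SV _ Sx)).
have fYS : f Y `\` sval S `<=` ~` sval S by move=> x [].
apply: nfSv; apply: (strong_component_closed (comp S) fSc fSc).
  apply: rt_trans (reachable_in_sub fXS (fXs _ _ fXc fXb)) _.
  exact: reachable_in_sub fYS (reach_flip bv).
apply: rt_trans (reachable_in_sub fYS va) _.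
exact: reachable_in_sub fXS (fXs _ _ fXa fXc).
Qed.

Lemma vertex_direction_ray :
  exists2 r, ray r & forall X, has_tail_in r (f X).
Proof.
have [e [Vsc Vrefl]] := exists_reflecting_sequence.
have fin n : finite_set [set e i | i in `I_n] := finite_image e (finite_II n).
pose Xn n : fin_subset D := exist _ _ (fin n).
have Xne n : sval (Xn n) `<=` range e by move=> _ [i _ <-]; exists i.
have [||x|r rr rW] := ray_through_levels (fun n => f (Xn n) `&` range e).
- move=> n x [fx ex]; split=> //; apply: mono fx => _ [i /= ilt <-].
  by exists i => //=; exact: ltnW.
- by move=> n; apply: Vsc.
- have [[i _ <-]|nx] := pselect (range e x); last by exists 0 => -[].
  exists i.+1 => -[fx _]; have [fX _ _] := comp (Xn i.+1).
  by apply: (fX _ fx); exists i => //=.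
exists r => // X.
have Yfin : finite_set (sval X `&` range e) by apply: finite_setIl; exact: svalP.
pose Y : fin_subset D := exist _ _ Yfin.
(* Once [Xn n] contains [Y], the tail in [f (Xn n)] lies in [f Y], and its vertices in [range e] lie
   in [f X]. *)
have [n Yn] := finite_sub_range_bounded Yfin (@subIsetr _ _ _).
have [k kP] := rW n; exists k => i /kP[fri eri].
apply: (reflecting_sub_component (range e) Vsc Vrefl X Y) => //; split=> //.
exact: mono fri.
Qed.

End VertexDirection.

(** * Ends and their directions *)

Section EndDirection.
Context {D : digraph}.

Lemma end_direction_in_vertex_directions (w : set (nat -> D)) :
  ends D w -> vertex_directions D (end_direction D w).
Proof.
move=> we; have cP X := (@end_componentP D X w we).1.
split=> [X|X Y XY]; first by case: (cP X).
have [r rs wr] := we.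
have rw : w r by rewrite wr; split=> // Z; have [K KZ rK] := rs.2 Z; exists K.
have [CX /(_ r rw)[k kP]] := cP X.
have [CY /(_ r rw)[l lP]] := cP Y.
(* The component for [Y] is strongly connected outside [X] and shares a vertex of [r] with the one
   for [X]. *)
apply: (strongly_connected_sub_component (x := r (maxn k l)) CX).
- by case: CY => CY _ _ x /CY Yx /XY.
- by case: CY.
- by apply: kP; exact: leq_maxl.
- by apply: lP; exact: leq_maxr.
Qed.

(** Rays of the two ends have tails in a common component for every [X], hence are equivalent. *)
Lemma end_direction_inj (w w' : set (nat -> D)) : ends D w -> ends D w' ->
  end_direction D w = end_direction D w' -> w `<=` w'.
Proof.
move=> we we' eqw t wt.
have [s ss ws] := we'.
have sw' : w' s by rewrite ws; split=> // Z; have [K KZ sK] := ss.2 Z; exists K.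
have st : solid_ray t by have [r _ wr] := we; move: wt; rewrite wr => -[].
rewrite ws; split=> // X.
have [[CX /(_ t wt) tC] _] := @end_componentP D X w we.
have [[_ /(_ s sw') sC] _] := @end_componentP D X w' we'.
exists (end_component X w) => //; split=> //.
by move/(congr1 (fun g => g X)): eqw; rewrite /end_direction => ->.
Qed.

(** Take the end of a ray with a tail in every [f X]; a component containing tails of all its rays
    is unique. *)
Lemma end_direction_surj (f : fin_subset D -> set D) :
  vertex_directions D f -> exists2 w, ends D w & end_direction D w = f.
Proof.
move=> hf; have [r rr rf] := vertex_direction_ray f hf.
have sr : solid_ray r by split=> // X; exists (f X) => //; case: hf.
pose w := [set s | solid_ray s /\ ray_equiv r s].
have we : ends D w by exists r.
exists w => //; apply/funext => X; symmetry.
apply: (@end_componentP D X w we).2; split; first by case: hf.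
move=> s [_ /(_ X)[K KX [rK sK]]].
by rewrite (tail_component_eq (hf.1 X) KX (rf X) rK).
Qed.

End EndDirection.

Theorem theorem4p1 (D : digraph) (D_infinite : infinite_set [set: D]) :
  set_bij (ends D) (vertex_directions D) (end_direction D).
Proof.
split.
- by move=> w; exact: end_direction_in_vertex_directions.
- move=> w w'; rewrite !inE => we we' eqw.
  by apply/seteqP; split; exact: end_direction_inj.
- by move=> f /end_direction_surj[w we <-]; exists w.
Qed.
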